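(* The integer $18$ is the smallest positive integer $n$ such that every permutation $p\in S_n$ has a monotone $2$-additive subsequence of length three.
   Context: $S_n$ denotes the set of permutations of $\{1,2,\ldots,n\}$ written in one-line notation $p=(p_1,p_2,\ldots,p_n)$. A subsequence of $p$ of length $k$ is a sequence $(p_{i_1},\ldots,p_{i_k})$ with $i_1<\cdots<i_k$. A sequence is monotone if it is increasing or decreasing. A sequence $(a_1,a_2,\ldots,a_k)$ of positive integers is $2$-additive if $a_1+a_2+\cdots+a_k=2a_1$ or $a_1+a_2+\cdots+a_k=2a_k$. *)

(* Defs.v *)
From mathcomp Require Import all_boot all_fingroup.

Set Implicit Arguments.
Unset Strict Implicit.
Unset Printing Implicit Defensive.

(* 'S_n permutes {0, ..., n-1}; the successor shifts the values to {1, ..., n}. *)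
Definition one_line (n : nat) (p : 'S_n) : seq nat :=
  [seq (nat_of_ord (p i)).+1 | i <- enum 'I_n].

Definition monotone (s : seq nat) : bool := sorted ltn s || sorted gtn s.

(* The default 0 of head and last only matters for the empty sequence. *)
Definition two_additive (s : seq nat) : bool :=
  (sumn s == 2 * head 0 s) || (sumn s == 2 * last 0 s).

Definition has_monotone_two_additive (k n : nat) (p : 'S_n) : Prop :=
  exists s : seq nat,
    [/\ subseq s (one_line p), size s = k, monotone s & two_additive s].

Definition unavoidable (k n : nat) : Prop :=
  forall p : 'S_n, has_monotone_two_additive k p.

(* Main.v *)
Require Import Defs.
From mathcomp Require Import all_boot all_fingroup.
From mathcomp Require Import zify.

(** A monotone 2-additive triple consists of values a < b < a + b whose middle
value b also stands between the other two in the word. A permutation avoids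
such triples exactly when, for all a < b, the values a and a + b stand on the
same side of b. Writing x << y for: x stands to the left of y, this says

   a << b  iff  a + b << b      and      b << a  iff  b << a + b.

These are equivalences between comparisons, not mere implications, and they act
on pairs of values like a subtractive Euclidean algorithm: for a < b < 2a the
comparison of a and b is that of a and b - a. A single known comparison thus
fixes a whole family of others (a << b, a + b << b, a + b << a + 2b, and so on
in Fibonacci fashion), and transitivity chains these families together. For the
values 1, ..., 18 the resulting propagation is strong enough that, after
assuming 1 << 2 by left-right symmetry, two further comparisons (1 with 4,
then 1 with 14 or with 13) lead to a contradiction in each of the four cases;
this is [no_sum_order]. The lemma [has_tripleP] translates between
monotone 2-additive subsequences and the same-side condition.

For the lower bound, one word on 1, ..., 17 without such a triple suffices:
deleting its values above n leaves a subsequence, which still has no triple and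
is the one-line notation of an element of S_n. *)

Set Implicit Arguments.
Unset Strict Implicit.
Unset Printing Implicit Defensive.

(** * Linear orders keeping a and a + b on the same side of b *)

(** [R] plays the role of the left-to-right order of a word on the values
1, ..., N; the bound on [a + b] keeps the condition within those values. *)
Definition sum_order (N : nat) (R : rel nat) : Prop :=
  [/\ transitive R,
      forall a b, 0 < a <= N -> 0 < b <= N -> a != b -> R b a = ~~ R a b
    & forall a b, 0 < a < b -> a + b <= N -> R a b = R (a + b) b].

Lemma sum_order_trans N R j i k :
  sum_order N R -> R i j -> R j k -> R i k.
Proof. by move=> [tr _ _]; apply: tr. Qed.

Lemma sum_order_suml N R a b :
  sum_order N R -> 0 < a < b -> a + b <= N -> R a b = R (a + b) b.
Proof. by move=> [_ _ sumR]; apply: sumR. Qed.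

(** This is the other half of the same-side condition: by totality, negating
[R a b = R (a + b) b] turns statements about the left of [b] into statements
about its right. *)
Lemma sum_order_sumr N R a b :
  sum_order N R -> 0 < a < b -> a + b <= N -> R b a = R b (a + b).
Proof.
move=> [_ tot sumR] hab hN.
have [ha hb nab] : [/\ 0 < a <= N, 0 < b <= N & a != b] by split; lia.
have [hs nsb] : 0 < a + b <= N /\ a + b != b by split; lia.
by rewrite (tot a b) // (tot (a + b) b) // (sumR a b).
Qed.

(** Reading a word backwards exchanges the two halves of the same-side
condition; this is the symmetry that allows one to assume that 1 precedes 2. *)
Lemma sum_order_rev N R : sum_order N R -> sum_order N (fun a b => R b a).
Proof.
move=> ordR; have [tr tot _] := ordR; split=> [b a c ba cb | a b ha hb nab | a b].
- exact: tr cb ba.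
- by rewrite (tot a b) // negbK.
- exact: sum_order_sumr.
Qed.

(** Proves [R a b] from a hypothesis [R a' b'] whose pair is reached from (a, b)
by subtracting the smaller value from the larger, as long as the remainder is
itself below the value subtracted. The side conditions are closed numerical
comparisons, and [isT] succeeds exactly when they hold. *)
Ltac descend ordR :=
  first
  [ assumption
  | match goal with |- is_true (?R ?a ?b) =>
      let d := eval compute in (a - b) in
      refine (etrans (esym (sum_order_suml ordR (a := d) (b := b) isT isT))
                     (_ : is_true (R d b)));
      descend ordR
    end
  | match goal with |- is_true (?R ?a ?b) =>
      let d := eval compute in (b - a) in
      refine (etrans (esym (sum_order_sumr ordR (a := d) (b := a) isT isT))
                     (_ : is_true (R a d)));
      descend ordR
    end ].

(** Applies the same subtractions to the proof term [h] of a comparison until it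
becomes a proof of the goal. *)
Ltac ascend ordR h :=
  first
  [ exact h
  | match type of h with is_true (?R ?a ?b) =>
      let d := eval compute in (a - b) in
      let h' := constr:(etrans (sum_order_suml ordR (a := d) (b := b) isT isT) h
                        : is_true (R d b)) in
      ascend ordR h'
    end
  | match type of h with is_true (?R ?a ?b) =>
      let d := eval compute in (b - a) in
      let h' := constr:(etrans (sum_order_sumr ordR (a := d) (b := a) isT isT) h
                        : is_true (R a d)) in
      ascend ordR h'
    end ].

(** [via ordR i j k] forms the transitive step from [i] to [k] through [j],
and concludes with a comparison equivalent to that of [i] and [k]. *)
Ltac via ordR i j k :=
  match type of ordR with sum_order _ ?R =>
    let h := fresh in
    assert (h : R i k);
    [ apply (sum_order_trans (j := j) ordR); descend ordR | ascend ordR h ]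
  end.

(** The transitive steps below use known comparisons as well as those that the same-side
equivalences derive from them, such as 15 << 14 from 1 << 14. The
splits on the pairs (1, 4), (1, 14) and (1, 13) are the only choices: all else
in each branch is forced, up to two opposite comparisons of one pair. *)
Lemma no_sum_order_1_before_2 R : sum_order 18 R -> R 1 2 -> False.
Proof.
move=> ordR h_1_2; have [_ tot _] := ordR.
have absurdR a b : 0 < a <= 18 -> 0 < b <= 18 -> a != b -> R a b -> R b a -> False.
  by move=> ha hb nab hab; rewrite (tot a b) ?hab.
have [h_1_4|] := boolP (R 1 4).
  have h_8_1 : R 8 1 by via ordR 8 5 9.
  have [h_1_14|] := boolP (R 1 14).
    have h_6_3 : R 6 3 by via ordR 15 14 9.
    have h_6_2 : R 6 2 by via ordR 6 3 2.
    have h_2_6 : R 2 6 by via ordR 8 1 14.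
    exact: absurdR h_2_6 h_6_2.
  rewrite -tot // => h_14_1.
  have h_8_2 : R 8 2 by via ordR 8 1 2.
  have h_14_4 : R 14 4 by via ordR 14 1 4.
  have h_4_10 : R 4 10 by via ordR 14 18 10.
  have h_3_1 : R 3 1 by via ordR 3 5 4.
  have h_7_3 : R 7 3 by via ordR 7 4 10.
  have h_7_1 : R 7 1 by via ordR 7 3 1.
  have h_6_3 : R 6 3 by via ordR 15 8 9.
  have h_6_1 : R 6 1 by via ordR 6 3 1.
  have h_1_6 : R 1 6 by via ordR 7 8 13.
  exact: absurdR h_1_6 h_6_1.
rewrite -tot // => h_4_1.
have h_4_2 : R 4 2 by via ordR 4 1 2.
have [h_1_13|] := boolP (R 1 13).
  have h_9_4 : R 9 4 by via ordR 9 14 13.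
  have h_9_1 : R 9 1 by via ordR 9 4 1.
  have h_2_7 : R 2 7 by via ordR 9 10 16.
  have h_1_3 : R 1 3 by via ordR 4 2 7.
  have h_3_6 : R 3 6 by via ordR 9 4 6.
  have h_1_6 : R 1 6 by via ordR 1 3 6.
  have h_5_1 : R 5 1 by via ordR 11 7 6.
  have h_1_5 : R 1 5 by via ordR 1 3 5.
  exact: absurdR h_1_5 h_5_1.
rewrite -tot // => h_13_1.
have h_2_6 : R 2 6 by via ordR 8 13 14.
have h_1_6 : R 1 6 by via ordR 1 2 6.
have h_7_1 : R 7 1 by via ordR 7 13 1.
have h_13_2 : R 13 2 by via ordR 13 1 2.
have h_1_7 : R 1 7 by via ordR 8 13 15.
exact: absurdR h_1_7 h_7_1.
Qed.

Lemma no_sum_order R : ~ sum_order 18 R.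
Proof.
move=> ordR; have [_ tot _] := ordR.
have [|] := boolP (R 1 2); first exact: no_sum_order_1_before_2.
by rewrite -tot //; apply: no_sum_order_1_before_2 (sum_order_rev ordR).
Qed.

(** * Monotone 2-additive triples as same-side failures *)

Definition before (s : seq nat) : rel nat :=
  fun a b => index a s < index b s.

Lemma before_trans s : transitive (before s).
Proof. by move=> b a c; apply: ltn_trans. Qed.

Lemma before_total s a b :
  a \in s -> b \in s -> a != b -> before s b a = ~~ before s a b.
Proof.
move=> sa sb nab; rewrite /before -leqNgt ltn_neqAle.
by case: eqP => // /(index_inj a sb sa) /esym/eqP; rewrite (negPf nab).
Qed.

(** Both the word and any list sorted by its left-to-right order are strictly
sorted, so such a list is determined by its set of entries and agrees with the
subsequence of the word having these entries. *)
Lemma subseq_before s t :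
  uniq s -> subseq t s = all [in s] t && sorted (before s) t.
Proof.
move=> us; have irr : irreflexive (before s) by move=> a; rewrite /before ltnn.
have ss : sorted (before s) s.
  apply/(sortedP 0) => i lt_i; rewrite /before !index_uniq //.
  exact: ltnW.
apply/idP/andP => [sub_ts | [/allP sub_ts st]].
  split; first exact/allP/mem_subseq.
  exact: (subseq_sorted (@before_trans s)) ss.
have -> : t = [seq x <- s | x \in t]; last exact: filter_subseq.
apply: (irr_sorted_eq (@before_trans s)) => //.
  exact: (sorted_filter (@before_trans s)).
by move=> x; rewrite mem_filter andb_idr //; apply: sub_ts.
Qed.

(** Boolean, so that it can be evaluated on a given word and negated without
classical logic. *)
Definition sums_on_one_side (s : seq nat) : bool :=
  all (fun b => all (fun a =>
    (a < b) && (a + b \in s) ==> (before s a b == before s (a + b) b)) s) s.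

Definition has_triple (s : seq nat) : Prop :=
  exists t, [/\ subseq t s, size t = 3, monotone t & two_additive t].

(** In a monotone triple of positive values, the sum is twice an end value only if
that end is the largest value, hence the sum of the other two. So the triple
reads a, b, a + b or a + b, b, a with a < b, which happens exactly when [b]
separates [a] from [a + b]. *)
Lemma has_tripleP s :
  uniq s -> 0 \notin s -> reflect (has_triple s) (~~ sums_on_one_side s).
Proof.
move=> us s0.
have pos (a : nat) : a \in s -> 0 < a.
  by move=> sa; rewrite lt0n; apply: contraNneq s0 => <-.
apply: (iffP allPn) => [[b sb /allPn[a sa]] | [t [sub_t t3 mono add]]].
  rewrite negb_imply => /andP[/andP[lt_ab sab]].
  have [a0 neq_ab] : 0 < a /\ a != b by rewrite neq_ltn lt_ab pos.
  have [lt_sum neq_sum] : b < a + b /\ a + b != b by lia.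
  case ab: (before s a b); case: (boolP (before s (a + b) b)) => // sum_b _.
    exists [:: a; b; a + b]; split=> //.
    - by rewrite subseq_before //= sa sb sab ab before_total ?sum_b.
    - by rewrite /monotone /= lt_ab lt_sum.
    - by apply/orP; right; rewrite /=; lia.
  exists [:: a + b; b; a]; split=> //.
  - by rewrite subseq_before //= sa sb sab sum_b before_total ?ab.
  - by rewrite /monotone /= lt_ab lt_sum orbT.
  - by apply/orP; left; rewrite /=; lia.
case: t t3 mono add sub_t => [|x [|y [|z []]]] //= _.
rewrite /monotone /two_additive subseq_before //= !andbT addn0.
move=> mono add /andP[/and3P[sx sy sz] /andP[xy yz]].
have [x0 z0] := (pos x sx, pos z sz); exists y => //; apply/allPn.
case/orP: mono => /andP[lt1 lt2].
  have z_sum : z = x + y by lia.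
  exists x => //; rewrite negb_imply lt1 -z_sum sz xy before_total ?yz //.
  by rewrite neq_ltn lt2.
have x_sum : x = z + y by lia.
exists z => //; rewrite negb_imply lt2 -x_sum sx xy before_total ?yz //.
by rewrite neq_ltn lt2 orbT.
Qed.

(** * One-line notation *)

Lemma perm_one_line n (p : 'S_n) : perm_eq (one_line p) (iota 1 n).
Proof.
apply: uniq_perm; rewrite ?iota_uniq //.
  by rewrite map_inj_uniq ?enum_uniq // => i j [] /ord_inj/perm_inj.
move=> k; rewrite mem_iota; apply/mapP/idP => [[i _ ->] | ].
  by rewrite add1n !ltnS leq0n ltn_ord.
case: k => // k; rewrite add1n /= ltnS => lt_k.
by exists ((p^-1)%g (Ordinal lt_k)); rewrite ?mem_enum ?permKV.
Qed.

Lemma one_line_onto n (s : seq nat) :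
  perm_eq s (iota 1 n) -> exists p : 'S_n, one_line p = s.
Proof.
move=> s_iota; have size_s : size s = n by rewrite (perm_size s_iota) size_iota.
have us : uniq s by rewrite (perm_uniq s_iota) iota_uniq.
have s_range (i : 'I_n) : 0 < nth 0 s i <= n.
  by rewrite -[_ <= n]ltnS -mem_iota -(perm_mem s_iota) mem_nth // size_s.
have lt_n (i : 'I_n) : (nth 0 s i).-1 < n by have := s_range i; lia.
pose f i := Ordinal (lt_n i).
have f_inj : injective f.
  move=> i j [eq_ij]; apply/val_inj/eqP.
  rewrite -(nth_uniq 0 _ _ us) ?size_s ?ltn_ord //.
  case/andP: (s_range i) (s_range j) => i0 _ /andP[j0 _].
  by rewrite -(prednK i0) -(prednK j0) eq_ij.
exists (perm f_inj); apply: (@eq_from_nth _ 0); rewrite size_map size_enum_ord //.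
move=> i lt_i; rewrite (nth_map (Ordinal lt_i)) ?size_enum_ord // permE /=.
by rewrite nth_enum_ord // prednK //; case/andP: (s_range (Ordinal lt_i)).
Qed.

(** * The bounds *)

(** Such a word can be found by inserting the values 1, 2, 3, ... one at a time:
the same-side conditions confine each new value to an interval of positions. *)
Definition avoiding_word : seq nat :=
  [:: 8; 10; 12; 14; 16; 3; 5; 1; 7; 11; 13; 17; 4; 2; 9; 15; 6].

Lemma avoiding_word_no_triple : ~ has_triple avoiding_word.
Proof. by apply/has_tripleP. Qed.

Lemma unavoidable_18 : unavoidable 3 18.
Proof.
move=> p; have p_iota := perm_one_line p.
have mem_p a : (a \in one_line p) = (0 < a <= 18).
  by rewrite (perm_mem p_iota) mem_iota.
apply/has_tripleP; rewrite ?mem_p ?(perm_uniq p_iota) ?iota_uniq //.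
apply/negP => sides; apply: (@no_sum_order (before (one_line p))).
split=> [||a b hab le_ab]; first exact: before_trans.
  by move=> a b ha hb; apply: before_total; rewrite mem_p.
have [sa sb sab] : [/\ 0 < a <= 18, 0 < b <= 18 & 0 < a + b <= 18] by split; lia.
move: sides => /allP/(_ b)/[!mem_p]/(_ sb)/allP/(_ a)/[!mem_p]/(_ sa).
by rewrite sab; case/andP: hab => _ -> /= /eqP.
Qed.

Theorem theorem5p5 :
  unavoidable 3 18 /\ (forall n : nat, 0 < n -> unavoidable 3 n -> 18 <= n).
Proof.
split=> [|n _ unav_n]; first exact: unavoidable_18.
rewrite leqNgt; apply/negP => lt_n.
have [|p p_word] := @one_line_onto n [seq k <- avoiding_word | k <= n].
  have <- : [seq k <- iota 1 17 | k <= n] = iota 1 n.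
    apply: (irr_sorted_eq ltn_trans ltnn); rewrite ?iota_ltn_sorted //.
      by apply: (sorted_filter ltn_trans); apply: iota_ltn_sorted.
    by move=> k; rewrite mem_filter !mem_iota; lia.
  exact: perm_filter.
have [t [sub_t t3 mono add]] := unav_n p.
case: avoiding_word_no_triple; exists t; split=> //.
by apply: subseq_trans sub_t _; rewrite p_word filter_subseq.
Qed.
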